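(* Let $H$ be a weak Hopf algebra and $(C,\leftharpoonup)$ a right partial $H$-module coalgebra. Suppose there exists an element $e\in H$ such that $\Delta(e)=e\otimes e$ and $c\leftharpoonup he=c\leftharpoonup h$ for all $c\in C$ and $h\in H$. Then $C$ has a globalization.
   Context: Everything is over a fixed field $\Bbbk$; Sweedler notation $\Delta(x)=x_1\otimes x_2$ is used. Weak Hopf algebra: a vector space $H$ that is an algebra and a coalgebra with $\Delta(hk)=\Delta(h)\Delta(k)$; $\varepsilon(hk\ell)=\varepsilon(hk_1)\varepsilon(k_2\ell)=\varepsilon(hk_2)\varepsilon(k_1\ell)$; $(1_H\otimes\Delta(1_H))(\Delta(1_H)\otimes1_H)=(\Delta(1_H)\otimes1_H)(1_H\otimes\Delta(1_H))=\Delta^2(1_H)$; together with a linear antipode $S:H\to H$ with $h_1S(h_2)=\varepsilon_t(h)$, $S(h_1)h_2=\varepsilon_s(h)$, $S(h_1)h_2S(h_3)=S(h)$, where $\varepsilon_t(h)=\varepsilon(1_1h)1_2$, $\varepsilon_s(h)=1_1\varepsilon(h1_2)$ and $1_1\otimes1_2=\Delta(1_H)$. Right partial $H$-module coalgebra: a coalgebra $C$ with a linear map $\leftharpoonup:C\otimes H\to C$ such that for all $c\in C$, $h,k\in H$: $c\leftharpoonup1_H=c$; $\Delta(c\leftharpoonup h)=c_1\leftharpoonup h_1\otimes c_2\leftharpoonup h_2$; $(c\leftharpoonup h)\leftharpoonup k=\varepsilon(c_1\leftharpoonup h_1)\,(c_2\leftharpoonup h_2k)$. Right $H$-module coalgebra: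 a coalgebra $D$ with a linear map $\blacktriangleleft:D\otimes H\to D$ such that $d\blacktriangleleft1_H=d$; $\Delta(d\blacktriangleleft h)=d_1\blacktriangleleft h_1\otimes d_2\blacktriangleleft h_2$; $(d\blacktriangleleft h)\blacktriangleleft k=d\blacktriangleleft hk$ (over a weak Hopf algebra the further axiom $\varepsilon(d\blacktriangleleft h)=\varepsilon(d\blacktriangleleft\varepsilon_t(h))$ is automatic). Globalization of a right partial $H$-module coalgebra $(C,\leftharpoonup)$: a triple $(D,\theta,\pi)$ such that (i) $D$ is a right $H$-module coalgebra via $\blacktriangleleft:D\otimes H\to D$; (ii) $\theta:C\to D$ is a coalgebra monomorphism; (iii) $\pi:D\to D$ is a linear projection onto $\theta(C)$ such that for all $c\in C$, $d\in D$, $h\in H$: $(\pi\otimes\pi)\Delta(d\blacktriangleleft h)=\Delta(\pi(d\blacktriangleleft h))$, $\pi(\pi(d)\blacktriangleleft h)=\varepsilon(\pi(d_1))\pi(d_2\blacktriangleleft h)$, and $\theta(c\leftharpoonup h)=\pi(\theta(c)\blacktriangleleft h)$; (iv) $D=\theta(C)\blacktriangleleft H$, i.e. $D$ is spanned by the elements $\theta(c)\blacktriangleleft h$. *)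

(* Defs.v *)
(* [boolp] is used only to decide the congruence defining the tensor product
   of arbitrary (possibly infinite-dimensional) vector spaces. *)
From HB Require Import structures.
From mathcomp Require Import all_boot all_algebra.
From mathcomp Require Import boolp.

Set Implicit Arguments.
Unset Strict Implicit.
Unset Printing Implicit Defensive.

Import GRing.Theory.
Local Open Scope ring_scope.
Local Open Scope quotient_scope.

Reserved Notation "x ⊗ y" (at level 41, right associativity).
Reserved Notation "x ⋅ y" (at level 40, left associativity).
Reserved Notation "\sw_ ( x , y <- c ) E"
  (at level 36, E at level 41, x name, y name, c at level 50,
   format "\sw_ ( x ,  y  <-  c )  E").

(* [tens V W] is the set of formal finite sums of pairs (v, w) modulo biadditivity
   and balancedness; the coefficients are absorbed in the pairs, and the
   opposite of (v, w) is (- v, w). *)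
Section TensorDef.
Variables (K : fieldType) (V W : lmodType K).

Inductive tens_cong : seq (V * W) -> seq (V * W) -> Prop :=
| tens_cong_refl s : tens_cong s s
| tens_cong_sym s t : tens_cong s t -> tens_cong t s
| tens_cong_trans s t u : tens_cong s t -> tens_cong t u -> tens_cong s u
| tens_cong_cat s s' t t' :
    tens_cong s s' -> tens_cong t t' -> tens_cong (s ++ t) (s' ++ t')
| tens_cong_catC s t : tens_cong (s ++ t) (t ++ s)
| tens_cong_0 : tens_cong [:: (0, 0)] [::]
| tens_cong_Dl v v' w :
    tens_cong [:: (v + v', w)] [:: (v, w); (v', w)]
| tens_cong_Dr v w w' :
    tens_cong [:: (v, w + w')] [:: (v, w); (v, w')]
| tens_cong_Z a v w : tens_cong [:: (a *: v, w)] [:: (v, a *: w)].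

Definition tens_congb (s t : seq (V * W)) : bool := `[< tens_cong s t >].

Lemma tens_congb_refl : reflexive tens_congb.
Proof. by move=> s; apply/asboolP/tens_cong_refl. Qed.

Lemma tens_congb_sym : symmetric tens_congb.
Proof.
by move=> s t; apply/asboolP/asboolP => /tens_cong_sym.
Qed.

Lemma tens_congb_trans : transitive tens_congb.
Proof.
move=> s t u /asboolP h1 /asboolP h2; apply/asboolP.
exact: tens_cong_trans h1 h2.
Qed.

Canonical tens_equiv_rel :=
  EquivRel tens_congb tens_congb_refl tens_congb_sym tens_congb_trans.

Definition tens := {eq_quot tens_congb}.
HB.instance Definition _ : EqQuotient _ tens_congb tens :=
  EqQuotient.on tens.
HB.instance Definition _ := Choice.on tens.

Lemma tens_piP s t : \pi_tens s = \pi_tens t <-> tens_cong s t.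
Proof.
by split=> [/eqquotP/asboolP // | h]; apply/eqquotP/asboolP.
Qed.

Let zero : tens := \pi_tens [::].
Let add (x y : tens) : tens := \pi_tens (repr x ++ repr y).
Let lscale (a : K) (s : seq (V * W)) := [seq (a *: p.1, p.2) | p <- s].
Let scale (a : K) (x : tens) : tens := \pi_tens (lscale a (repr x)).
Let opp (x : tens) : tens := scale (-1) x.

Let cong_repr s : tens_cong (repr (\pi_tens s)) s.
Proof. by apply/tens_piP; rewrite reprK. Qed.

Let addE s t : add (\pi_tens s) (\pi_tens t) = \pi_tens (s ++ t).
Proof. by apply/tens_piP/tens_cong_cat; apply: cong_repr. Qed.

Let cong_lscale a s t : tens_cong s t -> tens_cong (lscale a s) (lscale a t).
Proof.
elim=> {s t} [s|s t _|s t u _ h1 _ h2|s s' t t' _ h1 _ h2|s t||v v' w|v w w'|b v w].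
- exact: tens_cong_refl.
- exact: tens_cong_sym.
- exact: tens_cong_trans h1 h2.
- by rewrite /lscale !map_cat; apply: tens_cong_cat.
- by rewrite /lscale !map_cat; apply: tens_cong_catC.
- by rewrite /= scaler0; apply: tens_cong_0.
- by rewrite /= scalerDr; apply: tens_cong_Dl.
- exact: tens_cong_Dr.
- by rewrite /= scalerA mulrC -scalerA; apply: tens_cong_Z.
Qed.

Let scaleE a s : scale a (\pi_tens s) = \pi_tens (lscale a s).
Proof. by apply/tens_piP/cong_lscale/cong_repr. Qed.

Let tensW (P : tens -> Prop) : (forall s, P (\pi_tens s)) -> forall x, P x.
Proof. by move=> h x; rewrite -[x]reprK. Qed.

Let addA : associative add.
Proof.
by elim/tensW=> s; elim/tensW=> t; elim/tensW=> u; rewrite !addE catA.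
Qed.

Let addC : commutative add.
Proof.
elim/tensW=> s; elim/tensW=> t; rewrite !addE.
exact/tens_piP/tens_cong_catC.
Qed.

Let add0 : left_id zero add.
Proof. by elim/tensW=> s; rewrite addE. Qed.

Let cong_0l w : tens_cong [:: (0, w)] [::].
Proof.
have := tens_cong_Z 0 0 w; rewrite !scale0r => h.
exact: tens_cong_trans h tens_cong_0.
Qed.

Let scaleD x : {morph scale^~ x : a b / a + b >-> add a b}.
Proof.
move=> a b; elim/tensW: x => s; rewrite !scaleE addE; apply/tens_piP.
elim: s => [|[v w] s ih] /=; first exact: tens_cong_refl.
rewrite scalerDl -[_ :: lscale _ _]cat1s.
apply: (tens_cong_trans (tens_cong_cat (tens_cong_Dl _ _ _) ih)).
set A := lscale a s; set B := lscale b s.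
rewrite -[X in tens_cong X _]/([:: (a *: v, w)] ++ ([:: (b *: v, w)] ++ (A ++ B))).
rewrite -[X in tens_cong _ X]/([:: (a *: v, w)] ++ (A ++ ([:: (b *: v, w)] ++ B))).
apply: tens_cong_cat; first exact: tens_cong_refl.
rewrite !catA; apply: tens_cong_cat; last exact: tens_cong_refl.
exact: tens_cong_catC.
Qed.

Let scale1 : left_id 1 scale.
Proof.
elim/tensW=> s; rewrite scaleE; congr (\pi_tens _).
by rewrite /lscale -[RHS]map_id; apply: eq_map => -[v w] /=; rewrite scale1r.
Qed.

Let scale0 x : scale 0 x = zero.
Proof.
elim/tensW: x => s; rewrite scaleE; apply/tens_piP.
elim: s => [|[v w] s ih] /=; first exact: tens_cong_refl.
by rewrite scale0r -cat1s -[X in tens_cong _ X]cat0s; apply: tens_cong_cat.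
Qed.

Let addN : left_inverse zero opp add.
Proof.
by move=> x; rewrite /opp -{2}[x]scale1 -scaleD addNr scale0.
Qed.

HB.instance Definition _ := GRing.isZmodule.Build tens addA addC add0 addN.

Let scaleA a b x : scale a (scale b x) = scale (a * b) x.
Proof.
elim/tensW: x => s; rewrite !scaleE; congr (\pi_tens _).
by rewrite /lscale -map_comp; apply: eq_map => -[v w] /=; rewrite scalerA.
Qed.

Let scaleDr : right_distributive scale +%R.
Proof.
move=> a; elim/tensW=> s; elim/tensW=> t.
rewrite -[_ + _]/(add _ _) -[RHS]/(add _ _).
by rewrite addE !scaleE addE /lscale map_cat.
Qed.

HB.instance Definition _ :=
  GRing.Zmodule_isLmodule.Build K tens scaleA scale1 scaleDr scaleD.

Definition tpure (v : V) (w : W) : tens := \pi_tens [:: (v, w)].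

Lemma tens_piE s : \pi_tens s = \sum_(p <- s) tpure p.1 p.2.
Proof.
elim: s => [|[v w] s ih]; first by rewrite big_nil.
by rewrite big_cons -ih -[RHS]/(add _ _) addE.
Qed.

Lemma tpureDl v v' w : tpure (v + v') w = tpure v w + tpure v' w.
Proof. by rewrite -[RHS]/(add _ _) addE; apply/tens_piP/tens_cong_Dl. Qed.

Lemma tpureDr v w w' : tpure v (w + w') = tpure v w + tpure v w'.
Proof. by rewrite -[RHS]/(add _ _) addE; apply/tens_piP/tens_cong_Dr. Qed.

Lemma tpureZl a v w : tpure (a *: v) w = a *: tpure v w.
Proof. by rewrite -[RHS]/(scale _ _) scaleE. Qed.

Lemma tpureZr a v w : tpure v (a *: w) = a *: tpure v w.
Proof. by rewrite -tpureZl; apply/esym/tens_piP/tens_cong_Z. Qed.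

Lemma tensE (x : tens) : x = \sum_(p <- repr x) tpure p.1 p.2.
Proof. by rewrite -tens_piE reprK. Qed.

Lemma tens_ind (P : tens -> Prop) :
    P 0 -> (forall v w, P (tpure v w)) ->
    (forall x y, P x -> P y -> P (x + y)) ->
  forall x, P x.
Proof.
move=> P0 Pp PD x; rewrite (tensE x).
by elim/big_rec: _ => // p y _ Py; apply: PD.
Qed.

End TensorDef.

Notation "v ⊗ w" := (tpure v w) : ring_scope.

(* [tlift f] maps v_1 ⊗ w_1 + ... + v_n ⊗ w_n to f v_1 w_1 + ... + f v_n w_n.
   It is total in f, but is meaningful (independent of the representation of
   the tensor) only when f is biadditive and balanced, see [tlift_pure]; all
   uses below are of this kind. *)
Definition tlift (K : fieldType) (V W : lmodType K) (U : zmodType)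
    (f : V -> W -> U) (x : tens V W) : U :=
  \sum_(p <- repr x) f p.1 p.2.

Record balanced (K : fieldType) (V W : lmodType K) (U : zmodType)
    (f : V -> W -> U) : Prop := Balanced {
  balancedDl : forall v v' w, f (v + v') w = f v w + f v' w;
  balancedDr : forall v w w', f v (w + w') = f v w + f v w';
  balancedZ : forall a v w, f (a *: v) w = f v (a *: w) }.

Section TensorLift.
Variables (K : fieldType) (V W : lmodType K) (U : zmodType) (f : V -> W -> U).
Hypothesis fB : balanced f.

Let f0l w : f 0 w = 0.
Proof. by apply: (addIr (f 0 w)); rewrite -(balancedDl fB) !add0r. Qed.

Lemma tlift_pi s : tlift f (\pi_(tens V W) s) = \sum_(p <- s) f p.1 p.2.
Proof.
have H t u : tens_cong t u ->
    \sum_(p <- t) f p.1 p.2 = \sum_(p <- u) f p.1 p.2; last first.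
  by rewrite /tlift; apply/H/tens_piP; rewrite reprK.
elim=> {s t u} //.
- by move=> s t u _ -> _ ->.
- by move=> s s' t t' _ h1 _ h2; rewrite !big_cat /= h1 h2.
- by move=> s t; rewrite !big_cat /= addrC.
- by rewrite big_cons !big_nil /= f0l addr0.
- by move=> v v' w; rewrite !big_cons !big_nil /= !addr0 (balancedDl fB).
- by move=> v w w'; rewrite !big_cons !big_nil /= !addr0 (balancedDr fB).
- by move=> a v w; rewrite !big_cons !big_nil /= !addr0 (balancedZ fB).
Qed.

Lemma tlift_pure v w : tlift f (v ⊗ w) = f v w.
Proof. by rewrite tlift_pi big_seq1. Qed.

Lemma tlift0 : tlift f 0 = 0.
Proof. by rewrite -[0]/(\pi_(tens V W) [::]) tlift_pi big_nil. Qed.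

Lemma tliftD : {morph tlift f : x y / x + y}.
Proof.
move=> x y; rewrite -[x]reprK -[y]reprK.
by rewrite !tens_piE -big_cat -tens_piE !tlift_pi -!tens_piE !tlift_pi big_cat.
Qed.

End TensorLift.

Section TensorLiftLinear.
Variables (K : fieldType) (V W U : lmodType K) (f : V -> W -> U).

Definition tbilinear :=
  (forall w, linear (f^~ w)) /\ (forall v, linear (f v)).

Hypothesis fB : tbilinear.

Lemma tbilinear_balanced : balanced f.
Proof.
case: fB => fl fr; split=> [v v' w|v w w'|a v w].
- by have := fl w 1 v v'; rewrite !scale1r.
- by have := fr v 1 w w'; rewrite !scale1r.
have fl0 : f 0 w = 0.
  apply: (addIr (f 0 w)).
  by have := fl w 1 0 0; rewrite !scale1r !addr0 add0r => {1}<-.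
have fr0 : f v 0 = 0.
  apply: (addIr (f v 0)).
  by have := fr v 1 0 0; rewrite !scale1r !addr0 add0r => {1}<-.
have := fl w a v 0; rewrite addr0 fl0 addr0 => ->.
by have := fr v a w 0; rewrite addr0 fr0 addr0 => ->.
Qed.

Lemma tlift_linear : linear (tlift f).
Proof.
have fb := tbilinear_balanced.
move=> a x y; rewrite (tliftD fb); congr (_ + _).
elim/tens_ind: x => [|v w|x z hx hz]; first by rewrite !(scaler0, tlift0).
  rewrite -tpureZl !(tlift_pure fb); case: fB => fl _.
  have fl0 : f 0 w = 0.
    by apply: (addIr (f 0 w)); rewrite -(balancedDl fb) !add0r.
  by have := fl w a v 0; rewrite !addr0 fl0 addr0.
by rewrite scalerDr !(tliftD fb) hx hz scalerDr.
Qed.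

End TensorLiftLinear.

Lemma tens_ext (K : fieldType) (V W U : lmodType K)
    (f g : {linear tens V W -> U}) :
  (forall v w, f (v ⊗ w) = g (v ⊗ w)) -> f =1 g.
Proof.
move=> fg; elim/tens_ind => [|v w|x y hx hy]; first by rewrite !linear0.
  exact: fg.
by rewrite !linearD hx hy.
Qed.

Section TensorMap.
Variables (K : fieldType) (V V' W W' : lmodType K).

Definition tens_map (f : V -> V') (g : W -> W') : tens V W -> tens V' W' :=
  tlift (fun v w => f v ⊗ g w).

Variables (f : {linear V -> V'}) (g : {linear W -> W'}).

Lemma tens_map_bilinear : tbilinear (fun v w => f v ⊗ g w).
Proof.
split=> [w a v v'|v a w w'].
  by rewrite linearP tpureDl tpureZl.
by rewrite linearP tpureDr tpureZr.
Qed.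

Lemma tens_map_linear : linear (tens_map f g).
Proof. exact: tlift_linear tens_map_bilinear. Qed.

HB.instance Definition _ :=
  GRing.isLinear.Build K (tens V W) (tens V' W') _ (tens_map f g) tens_map_linear.

Lemma tens_map_pure v w : tens_map f g (v ⊗ w) = f v ⊗ g w.
Proof. exact: tlift_pure (tbilinear_balanced tens_map_bilinear) _ _. Qed.

End TensorMap.

Section TensorAssoc.
Variables (K : fieldType) (U V W : lmodType K).

Definition tens_assoc : tens (tens U V) W -> tens U (tens V W) :=
  tlift (fun t w => tlift (fun u v => u ⊗ (v ⊗ w)) t).

Let inner_bilinear (w : W) : tbilinear (fun (u : U) (v : V) => u ⊗ (v ⊗ w)).
Proof.
split=> [v a u u'|u a v v']; first by rewrite tpureDl tpureZl.
by rewrite tpureDl tpureZl tpureDr tpureZr.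
Qed.

Let outer_bilinear :
  tbilinear (fun (t : tens U V) (w : W) => tlift (fun u v => u ⊗ (v ⊗ w)) t).
Proof.
split=> [w|t a w w']; first exact: tlift_linear (inner_bilinear w).
have innerB x := tbilinear_balanced (inner_bilinear x).
elim/tens_ind: t => [|u v|x y hx hy].
- by rewrite !tlift0 // scaler0 addr0.
- by rewrite !tlift_pure // tpureDr tpureZr tpureDr tpureZr.
- by rewrite !tliftD // hx hy scalerDr addrACA.
Qed.

Lemma tens_assoc_linear : linear tens_assoc.
Proof. exact: tlift_linear outer_bilinear. Qed.

HB.instance Definition _ :=
  GRing.isLinear.Build K (tens (tens U V) W) (tens U (tens V W)) _ tens_assoc
    tens_assoc_linear.

Lemma tens_assoc_pure u v w : tens_assoc ((u ⊗ v) ⊗ w) = u ⊗ (v ⊗ w).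
Proof.
rewrite /tens_assoc (tlift_pure (tbilinear_balanced outer_bilinear)).
exact: tlift_pure (tbilinear_balanced (inner_bilinear w)) _ _.
Qed.

End TensorAssoc.

(* Unital associative algebras. The library's [algType] would impose 1 != 0,
   which is not assumed here. *)
HB.mixin Record isAlgebra (K : fieldType) A of GRing.Lmodule K A := {
  amul : {linear tens A A -> A};
  aone : A;
  amulA : forall x y z : A,
    amul (x ⊗ amul (y ⊗ z)) = amul (amul (x ⊗ y) ⊗ z);
  amul1l : forall x : A, amul (aone ⊗ x) = x;
  amul1r : forall x : A, amul (x ⊗ aone) = x }.
#[short(type="unitalAlgType")]
HB.structure Definition UnitalAlg (K : fieldType) :=
  {A of GRing.Lmodule K A & isAlgebra K A}.

Notation "x ⋅ y" := (amul (x ⊗ y)) : ring_scope.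

(* The tensor product of two algebras: (a ⊗ b) ⋅ (a' ⊗ b') = aa' ⊗ bb'. *)
Section TensorAlgebra.
Variables (K : fieldType) (A B : unitalAlgType K).

Definition tens_mul_fun (x y : tens A B) : tens A B :=
  tlift (fun a b => tlift (fun a' b' => (a ⋅ a') ⊗ (b ⋅ b')) y) x.

Let inner_bilinear (a : A) (b : B) :
  tbilinear (fun a' b' => (a ⋅ a') ⊗ (b ⋅ b')).
Proof.
split=> [b' c a' a''|a' c b' b''].
  by rewrite tpureDr tpureZr linearP tpureDl tpureZl.
by rewrite tpureDr tpureZr linearP tpureDr tpureZr.
Qed.

Let outer_bilinear (y : tens A B) :
  tbilinear (fun a b => tlift (fun a' b' => (a ⋅ a') ⊗ (b ⋅ b')) y).
Proof.
have innerB u v := tbilinear_balanced (inner_bilinear u v).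
split=> [b c a a'|a c b b'].
  elim/tens_ind: y => [|u v|x z hx hz].
  - by rewrite !tlift0 // scaler0 addr0.
  - by rewrite !tlift_pure // tpureDl tpureZl linearP tpureDl tpureZl.
  - by rewrite !tliftD // hx hz scalerDr addrACA.
elim/tens_ind: y => [|u v|x z hx hz].
- by rewrite !tlift0 // scaler0 addr0.
- by rewrite !tlift_pure // tpureDl tpureZl linearP tpureDr tpureZr.
- by rewrite !tliftD // hx hz scalerDr addrACA.
Qed.

Lemma tens_mul_fun_pure a b a' b' :
  tens_mul_fun (a ⊗ b) (a' ⊗ b') = (a ⋅ a') ⊗ (b ⋅ b').
Proof.
rewrite /tens_mul_fun (tlift_pure (tbilinear_balanced (outer_bilinear _))).
exact: tlift_pure (tbilinear_balanced (inner_bilinear _ _)) _ _.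
Qed.

Lemma tens_mul_fun_bilinear : tbilinear tens_mul_fun.
Proof.
split=> [y|x c y z]; first exact: tlift_linear (outer_bilinear y).
have outerB u := tbilinear_balanced (outer_bilinear u).
elim/tens_ind: x => [|a b|x x' hx hx'].
- by rewrite /tens_mul_fun !tlift0 // scaler0 addr0.
- rewrite /tens_mul_fun !tlift_pure //.
  exact: (tlift_linear (inner_bilinear a b)).
- rewrite /tens_mul_fun !tliftD // -!/(tens_mul_fun _ _) hx hx'.
  by rewrite scalerDr addrACA.
Qed.

Let tens_mulB := tbilinear_balanced tens_mul_fun_bilinear.

Definition tens_mul : tens (tens A B) (tens A B) -> tens A B := tlift tens_mul_fun.

Lemma tens_mul_linear : linear tens_mul.
Proof. exact: tlift_linear tens_mul_fun_bilinear. Qed.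

HB.instance Definition _ :=
  GRing.isLinear.Build K (tens (tens A B) (tens A B)) (tens A B) _ tens_mul tens_mul_linear.

Let mulE x y : tens_mul (x ⊗ y) = tens_mul_fun x y.
Proof. exact: tlift_pure. Qed.

Let mulA (x y z : tens A B) :
  tens_mul (x ⊗ tens_mul (y ⊗ z)) = tens_mul (tens_mul (x ⊗ y) ⊗ z).
Proof.
rewrite !mulE; case: tens_mulB => mDl mDr _.
have m0l u : tens_mul_fun 0 u = 0.
  by apply: (addIr (tens_mul_fun 0 u)); rewrite -mDl !add0r.
have m0r u : tens_mul_fun u 0 = 0.
  by apply: (addIr (tens_mul_fun u 0)); rewrite -mDr !add0r.
elim/tens_ind: x => [|a b|x x' h h']; first by rewrite !m0l.
  elim/tens_ind: y => [|a' b'|y y' h h']; first by rewrite !(m0l, m0r).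
    elim/tens_ind: z => [|a'' b''|z z' h h']; first by rewrite !m0r.
      by rewrite !tens_mul_fun_pure !amulA.
    by rewrite !mDr h h'.
  by rewrite mDl !mDr h h' mDl.
by rewrite !mDl h h'.
Qed.

Let mul1l (x : tens A B) : tens_mul ((aone ⊗ aone) ⊗ x) = x.
Proof.
rewrite mulE; case: tens_mulB => _ mDr _.
elim/tens_ind: x => [|a b|x y h h'].
- apply: (addIr (tens_mul_fun (aone ⊗ aone) 0)).
  by rewrite -mDr !add0r.
- by rewrite tens_mul_fun_pure !amul1l.
- by rewrite mDr h h'.
Qed.

Let mul1r (x : tens A B) : tens_mul (x ⊗ (aone ⊗ aone)) = x.
Proof.
rewrite mulE; case: tens_mulB => mDl _ _.
elim/tens_ind: x => [|a b|x y h h'].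
- apply: (addIr (tens_mul_fun 0 (aone ⊗ aone))).
  by rewrite -mDl !add0r.
- by rewrite tens_mul_fun_pure !amul1r.
- by rewrite mDl h h'.
Qed.

HB.instance Definition _ :=
  isAlgebra.Build K (tens A B) mulA mul1l mul1r.

Lemma tens_mul_pure (a a' : A) (b b' : B) :
  (a ⊗ b) ⋅ (a' ⊗ b') = (a ⋅ a') ⊗ (b ⋅ b').
Proof. by rewrite -tens_mul_fun_pure -mulE. Qed.

End TensorAlgebra.

HB.mixin Record isCoalgebra (K : fieldType) C of GRing.Lmodule K C := {
  comul : {linear C -> tens C C};
  counit : {scalar C};
  comulA : forall c : C,
    tens_assoc (tens_map comul idfun (comul c)) =
    tens_map idfun comul (comul c);
  counitl : forall c : C, tlift (fun c1 c2 => counit c1 *: c2) (comul c) = c;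
  counitr : forall c : C, tlift (fun c1 c2 => counit c2 *: c1) (comul c) = c }.
#[short(type="coalgType")]
HB.structure Definition Coalgebra (K : fieldType) :=
  {C of GRing.Lmodule K C & isCoalgebra K C}.

(* Sweedler notation: in [\sw_(x, y <- c) E], E(x, y) must be bilinear and
   x ⊗ y runs through the terms of the comultiplication of c. *)
Notation "\sw_ ( x , y <- c ) E" := (tlift (fun x y => E) (comul c))
  : ring_scope.

HB.mixin Record isWeakBialgebra (K : fieldType) H
    of UnitalAlg K H & Coalgebra K H := {
  comulM : forall h k : H, comul (h ⋅ k) = comul h ⋅ comul k;
  counitMl : forall h k l : H,
    counit (h ⋅ k ⋅ l) = \sw_(k1, k2 <- k) (counit (h ⋅ k1) * counit (k2 ⋅ l));
  counitMr : forall h k l : H,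
    counit (h ⋅ k ⋅ l) = \sw_(k1, k2 <- k) (counit (h ⋅ k2) * counit (k1 ⋅ l));
  comul1l :
    ((aone : H) ⊗ comul (aone : H)) ⋅ tens_assoc (comul (aone : H) ⊗ (aone : H)) =
    tens_map idfun comul (comul (aone : H));
  comul1r :
    tens_assoc (comul (aone : H) ⊗ (aone : H)) ⋅ ((aone : H) ⊗ comul (aone : H)) =
    tens_map idfun comul (comul (aone : H)) }.
#[short(type="weakBialgType")]
HB.structure Definition WeakBialgebra (K : fieldType) :=
  {H of UnitalAlg K H & Coalgebra K H & isWeakBialgebra K H}.

Definition eps_t (K : fieldType) (H : weakBialgType K) (h : H) : H :=
  \sw_(u1, u2 <- (aone : H)) (counit (u1 ⋅ h) *: u2).

Definition eps_s (K : fieldType) (H : weakBialgType K) (h : H) : H :=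
  \sw_(u1, u2 <- (aone : H)) (counit (h ⋅ u2) *: u1).

HB.mixin Record isWeakHopf (K : fieldType) H of WeakBialgebra K H := {
  antipode : {linear H -> H};
  antipode_t : forall h : H, \sw_(h1, h2 <- h) (h1 ⋅ antipode h2) = eps_t h;
  antipode_s : forall h : H, \sw_(h1, h2 <- h) (antipode h1 ⋅ h2) = eps_s h;
  antipodeE : forall h : H,
    \sw_(h12, h3 <- h)
      \sw_(h1, h2 <- h12) (antipode h1 ⋅ h2 ⋅ antipode h3) = antipode h }.
#[short(type="weakHopfType")]
HB.structure Definition WeakHopf (K : fieldType) :=
  {H of WeakBialgebra K H & isWeakHopf K H}.

Section Actions.
Variables (K : fieldType) (H : weakHopfType K).

Record partial_module_coalgebra (C : coalgType K) (act : {linear tens C H -> C}) :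
    Prop := PartialModuleCoalgebra {
  pact1 : forall c, act (c ⊗ aone) = c;
  pact_comul : forall c h,
    comul (act (c ⊗ h)) =
    \sw_(c1, c2 <- c) \sw_(h1, h2 <- h) (act (c1 ⊗ h1) ⊗ act (c2 ⊗ h2));
  pactA : forall c h k,
    act (act (c ⊗ h) ⊗ k) =
    \sw_(c1, c2 <- c) \sw_(h1, h2 <- h)
      (counit (act (c1 ⊗ h1)) *: act (c2 ⊗ (h2 ⋅ k))) }.

Record module_coalgebra (D : coalgType K) (act : {linear tens D H -> D}) :
    Prop := ModuleCoalgebra {
  act1 : forall d, act (d ⊗ aone) = d;
  act_comul : forall d h,
    comul (act (d ⊗ h)) =
    \sw_(d1, d2 <- d) \sw_(h1, h2 <- h) (act (d1 ⊗ h1) ⊗ act (d2 ⊗ h2));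
  actA : forall d h k, act (act (d ⊗ h) ⊗ k) = act (d ⊗ (h ⋅ k)) }.

(* Monomorphisms of coalgebras are understood as injective morphisms; the
   categorical notion is weaker in general. *)
Record coalgebra_mono (C D : coalgType K) (theta : {linear C -> D}) :
    Prop := CoalgebraMono {
  mono_inj : injective theta;
  mono_comul : forall c, comul (theta c) = tens_map theta theta (comul c);
  mono_counit : forall c, counit (theta c) = counit c }.

Record projection_onto (C D : lmodType K) (theta : {linear C -> D})
    (p : {linear D -> D}) : Prop := ProjectionOnto {
  proj_idem : forall d, p (p d) = p d;
  proj_image : forall d, (exists d', p d' = d) <-> (exists c, theta c = d) }.

Record globalization (C : coalgType K) (pact : {linear tens C H -> C})
    (D : coalgType K) (act : {linear tens D H -> D})
    (theta : {linear C -> D}) (p : {linear D -> D}) :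
    Prop := Globalization {
  glob_module : module_coalgebra act;
  glob_mono : coalgebra_mono theta;
  glob_proj : projection_onto theta p;
  glob_comul : forall d h,
    tens_map p p (comul (act (d ⊗ h))) = comul (p (act (d ⊗ h)));
  glob_act : forall d h,
    p (act (p d ⊗ h)) =
    \sw_(d1, d2 <- d) (counit (p d1) *: p (act (d2 ⊗ h)));
  glob_pact : forall c h, theta (pact (c ⊗ h)) = p (act (theta c ⊗ h));
  glob_span : forall d, exists s : seq (C * H),
    d = \sum_(q <- s) act (theta q.1 ⊗ q.2) }.

Definition has_globalization (C : coalgType K) (pact : {linear tens C H -> C}) :
    Prop :=
  exists (D : coalgType K) (act : {linear tens D H -> D})
         (theta : {linear C -> D}) (p : {linear D -> D}),
    globalization pact act theta p.

End Actions.

(* Main.v *)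
Require Import Defs.
From HB Require Import structures.
From mathcomp Require Import all_boot all_algebra.
Import GRing.Theory.
Local Open Scope ring_scope.

Set Implicit Arguments.
Unset Strict Implicit.
Unset Printing Implicit Defensive.

(* The globalization is D = C ⊗ eH, with H acting by right multiplication on the
   second factor, theta(c) = c ⊗ e and pi = theta o (↼): applying the partial
   action axiom to c = c ↼ e gives c ↼ eh = c ↼ h, hence theta(c ↼ h) =
   pi(theta(c) ◂ h). Since e S(e) e = e for a grouplike e, D is the image of the
   idempotent c ⊗ h |-> c ⊗ e S(e) h of the tensor coalgebra C ⊗ H, so that its
   comultiplication is obtained from that of C ⊗ H by projecting both factors;
   this avoids any use of bases or flatness. *)

(** * Computation rules for lifts and maps of tensors *)

Section TensorLiftTheory.
Variables (K : fieldType).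
Implicit Types (V W U : lmodType K).

Lemma tpure_linearl V W (w : W) : linear (fun v : V => v ⊗ w).
Proof. by move=> a v v'; rewrite tpureDl tpureZl. Qed.

Lemma tpure_linearr V W (v : V) : linear (fun w : W => v ⊗ w).
Proof. by move=> a w w'; rewrite tpureDr tpureZr. Qed.

Definition tens_with V W (w : W) (v : V) := v ⊗ w.

HB.instance Definition _ V W (w : W) :=
  GRing.isLinear.Build K V (tens V W) _ (tens_with w) (@tpure_linearl V W w).

Lemma tpure0l V W (w : W) : (0 : V) ⊗ w = 0.
Proof. by rewrite -[0 in LHS](scale0r 0) tpureZl scale0r. Qed.

Lemma tpure0r V W (v : V) : v ⊗ (0 : W) = 0.
Proof. by rewrite -[0 in LHS](scale0r 0) tpureZr scale0r. Qed.

Lemma tlift_tpure V W (x : tens V W) : tlift (@tpure K V W) x = x.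
Proof. by rewrite [RHS]tensE. Qed.

Lemma eq_tlift V W (U : zmodType) (f g : V -> W -> U) (x : tens V W) :
  (forall v w, f v w = g v w) -> tlift f x = tlift g x.
Proof. by move=> fg; apply: eq_bigr => p _; apply: fg. Qed.

(** [tlift] is a finite sum over a chosen representative, so a linear map passes through it
    termwise; [linear_bigtlift] and [tlift_exchange] rest on the same remark. *)
Lemma linear_tlift V W U U' (L : U -> U') (f : V -> W -> U) (x : tens V W) :
  linear L -> L (tlift f x) = tlift (fun v w => L (f v w)) x.
Proof.
move=> Llin.
pose L' : {linear U -> U'} := HB.pack L (GRing.isLinear.Build K U U' _ L Llin).
by rewrite -[L]/(L' : U -> U') /tlift linear_sum.
Qed.

Lemma linear_bigtlift V W U U' (g : V -> W -> U -> U') (x : tens V W) :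
  (forall v w, linear (g v w)) -> linear (fun u => tlift (fun v w => g v w u) x).
Proof.
move=> glin a u u'; rewrite /tlift scaler_sumr -big_split /=.
by apply: eq_bigr => p _; apply: glin.
Qed.

Lemma tlift_exchange V W V' W' U (f : V -> W -> V' -> W' -> U)
    (x : tens V W) (y : tens V' W') :
  tlift (fun v w => tlift (f v w) y) x =
  tlift (fun v' w' => tlift (fun v w => f v w v' w') x) y.
Proof. exact: exchange_big. Qed.

Lemma tlift_bilinear_pure V W U (f : V -> W -> U) v w :
  tbilinear f -> tlift f (v ⊗ w) = f v w.
Proof. by move=> fB; apply: tlift_pure; apply: tbilinear_balanced. Qed.

Lemma tlift_tens_map V W V' W' U (f : V' -> W' -> U) (g : V -> V') (h : W -> W')
    (x : tens V W) :
  tbilinear f -> tlift f (tens_map g h x) = tlift (fun v w => f (g v) (h w)) x.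
Proof.
move=> fB; rewrite (linear_tlift _ _ (tlift_linear fB)).
by apply: eq_tlift => v w; rewrite tlift_bilinear_pure.
Qed.

Lemma tens_map_id V W (x : tens V W) : tens_map idfun idfun x = x.
Proof. exact: tlift_tpure. Qed.

Lemma eq_tens_map V W V' W' (f f' : V -> V') (g g' : W -> W') :
  f =1 f' -> g =1 g' -> tens_map f g =1 tens_map f' g'.
Proof. by move=> ff gg x; apply: eq_tlift => v w; rewrite ff gg. Qed.

Lemma tens_map_comp V V' V'' W W' W'' (f : {linear V' -> V''}) (f' : V -> V')
    (g : {linear W' -> W''}) (g' : W -> W') (x : tens V W) :
  tens_map f g (tens_map f' g' x) = tens_map (f \o f') (g \o g') x.
Proof. exact/tlift_tens_map/tens_map_bilinear. Qed.

(** Functoriality gives the tensor square of a split embedding a left inverse, so equalities in a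
    tensor square can be tested after such an embedding. *)
Lemma tens_map_can V W V' W' (f : V -> V') (g : W -> W')
    (f' : {linear V' -> V}) (g' : {linear W' -> W}) :
  cancel f f' -> cancel g g' -> cancel (tens_map f g) (tens_map f' g').
Proof.
by move=> fK gK x; rewrite tens_map_comp -[RHS]tens_map_id; apply: eq_tens_map.
Qed.

Lemma tens_assoc_map U U' V V' W W' (f : {linear U -> U'}) (g : {linear V -> V'})
    (h : {linear W -> W'}) (x : tens (tens U V) W) :
  tens_assoc (tens_map (tens_map f g) h x) =
  tens_map f (tens_map g h) (tens_assoc x).
Proof.
elim/tens_ind: x => [|x w|x y hx hy]; rewrite ?linear0 //; last first.
  by rewrite !linearD /= hx hy.
rewrite tens_map_pure /=.
elim/tens_ind: x => [|u v|x y hx hy]; first by rewrite linear0 !tpure0l !linear0.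
  by rewrite tens_map_pure !tens_assoc_pure !tens_map_pure /= tens_map_pure.
by rewrite linearD !tpureDl !linearD /= hx hy.
Qed.

End TensorLiftTheory.

(** * Interchange of the middle tensor factors *)

Section MiddleExchange.
Variables (K : fieldType) (V V' W W' : lmodType K).

Definition tens_mid :
    tens (tens V V') (tens W W') -> tens (tens V W) (tens V' W') :=
  tlift (fun y z =>
    tlift (fun v v' => tlift (fun w w' => (v ⊗ w) ⊗ (v' ⊗ w')) z) y).

Lemma tpure2_bilinear (v : V) (v' : V') :
  tbilinear (fun (w : W) (w' : W') => (v ⊗ w) ⊗ (v' ⊗ w')).
Proof.
split=> [w' a w w2|w a w' w2]; first by rewrite tpureDr tpureZr tpureDl tpureZl.
by rewrite !(tpureDr, tpureZr).
Qed.

Let innerB' (w : W) (w' : W') :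
  tbilinear (fun (v : V) (v' : V') => (v ⊗ w) ⊗ (v' ⊗ w')).
Proof.
split=> [v' a v v2|v a v' v2]; first by rewrite !(tpureDl, tpureZl).
by rewrite tpureDl tpureZl tpureDr tpureZr.
Qed.

Let midB : tbilinear (fun (y : tens V V') (z : tens W W') =>
  tlift (fun v v' => tlift (fun w w' => (v ⊗ w) ⊗ (v' ⊗ w')) z) y).
Proof.
split=> [z|y].
  (* The outer sum runs over a representative of [y], which is not additive in [y]; after the
     exchange [y] occurs only in inner lifts, which are linear. *)
  move=> a y y'; rewrite !(tlift_exchange _ _ z).
  exact: (linear_bigtlift _ (fun w w' => tlift_linear (innerB' w w'))).
exact: (linear_bigtlift _ (fun v v' => tlift_linear (tpure2_bilinear v v'))).
Qed.

Lemma tens_mid_linear : linear tens_mid.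
Proof. exact: tlift_linear midB. Qed.

HB.instance Definition _ :=
  GRing.isLinear.Build K (tens (tens V V') (tens W W'))
    (tens (tens V W) (tens V' W')) _ tens_mid tens_mid_linear.

Lemma tens_midE y z : tens_mid (y ⊗ z) =
  tlift (fun v v' => tlift (fun w w' => (v ⊗ w) ⊗ (v' ⊗ w')) z) y.
Proof. exact: tlift_bilinear_pure. Qed.

Lemma tens_mid_pure v v' w w' :
  tens_mid ((v ⊗ v') ⊗ (w ⊗ w')) = (v ⊗ w) ⊗ (v' ⊗ w').
Proof.
rewrite tens_midE -[RHS](tlift_bilinear_pure v v' (innerB' w w')).
by apply: eq_tlift => x x'; apply/tlift_bilinear_pure/tpure2_bilinear.
Qed.

Lemma tlift_tens_mid (U : lmodType K) (f : tens V W -> tens V' W' -> U) y z :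
    tbilinear f ->
  tlift f (tens_mid (y ⊗ z)) =
  tlift (fun v v' => tlift (fun w w' => f (v ⊗ w) (v' ⊗ w')) z) y.
Proof.
move=> fB; rewrite tens_midE (linear_tlift _ _ (tlift_linear fB)).
apply: eq_tlift => v v'; rewrite (linear_tlift _ _ (tlift_linear fB)).
by apply: eq_tlift => w w'; rewrite tlift_bilinear_pure.
Qed.

End MiddleExchange.

Lemma tens_ext2 (K : fieldType) (V W V' W' U : lmodType K)
    (f g : {linear tens (tens V W) (tens V' W') -> U}) :
    (forall v w v' w', f ((v ⊗ w) ⊗ (v' ⊗ w')) = g ((v ⊗ w) ⊗ (v' ⊗ w'))) ->
  f =1 g.
Proof.
move=> fg; apply: tens_ext => y z.
elim/tens_ind: y => [|v w|y y' h h']; first by rewrite tpure0l !linear0.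
  elim/tens_ind: z => [|v' w'|z z' h h']; first by rewrite tpure0r !linear0.
    exact: fg.
  by rewrite tpureDr !linearD h h'.
by rewrite tpureDl !linearD h h'.
Qed.

Lemma tens_ext3 (K : fieldType) (V V' W W' T T' U : lmodType K)
    (f g : {linear tens (tens (tens V V') (tens W W')) (tens T T') -> U}) :
    (forall v v' w w' t t', f (((v ⊗ v') ⊗ (w ⊗ w')) ⊗ (t ⊗ t')) =
                            g (((v ⊗ v') ⊗ (w ⊗ w')) ⊗ (t ⊗ t'))) ->
  f =1 g.
Proof.
move=> fg; apply: tens_ext => x z.
elim/tens_ind: z => [|t t'|z z' h h']; first by rewrite tpure0r !linear0.
  (* Freezing the last factor [t ⊗ t'] with [tens_with] leaves the case of four factors. *)
  by have /= := @tens_ext2 K V V' W W' U (f \o tens_with (t ⊗ t'))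
    (g \o tens_with (t ⊗ t')); apply=> v v' w w'; apply: fg.
by rewrite tpureDr !linearD h h'.
Qed.

Section CounitScale.
Variables (K : fieldType) (C : coalgType K).

Lemma counit_scalel_bilinear :
  tbilinear (fun c1 c2 : C => counit c1 *: c2).
Proof.
split=> [d a c c'|d a c c'].
  by rewrite linearP /= scalerDl scalerA.
by rewrite linearP /=.
Qed.

Lemma counit_scaler_bilinear :
  tbilinear (fun c1 c2 : C => counit c2 *: c1).
Proof.
split=> [d a c c'|d a c c'].
  by rewrite linearP /=.
by rewrite linearP /= scalerDl scalerA.
Qed.

End CounitScale.

(** * The tensor product of two coalgebras *)

Section TensorCoalgebra.
Variables (K : fieldType) (C H : coalgType K).

Definition tens_comul : tens C H -> tens (tens C H) (tens C H) :=
  @tens_mid K C C H H \o tens_map comul comul.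

HB.instance Definition _ := GRing.Linear.on tens_comul.

Lemma tens_comul_pure c h : tens_comul (c ⊗ h) = tens_mid (comul c ⊗ comul h).
Proof. by rewrite /tens_comul /= tens_map_pure. Qed.

Let counitB : tbilinear (fun (c : C) (h : H) => (counit c * counit h : K^o)).
Proof.
split=> [h a c c'|c a h h']; rewrite linearP /=.
  by rewrite mulrDl scalerAl.
by rewrite mulrDr scalerAr.
Qed.

Definition tens_counit : tens C H -> K :=
  tlift (fun c h => counit c * counit h).

HB.instance Definition _ := GRing.isLinear.Build K (tens C H) K _ tens_counit
  (tlift_linear counitB).

Lemma tens_counit_pure c h : tens_counit (c ⊗ h) = counit c * counit h.
Proof. exact: (tlift_bilinear_pure _ _ counitB). Qed.

Let tens_comulA (x : tens C H) :
  tens_assoc (tens_map tens_comul idfun (tens_comul x)) =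
  tens_map idfun tens_comul (tens_comul x).
Proof.
elim/tens_ind: x => [|c h|x y hx hy]; rewrite ?linear0 ?linearD /= ?hx ?hy //.
rewrite tens_comul_pure.
(* (c1 ⊗ (c2 ⊗ c3)) ⊗ (h1 ⊗ (h2 ⊗ h3)) |-> (c1 ⊗ h1) ⊗ ((c2 ⊗ h2) ⊗ (c3 ⊗ h3));
   both sides are its value on the iterated comultiplications of c and h. *)
pose mid3 : tens (tens C (tens C C)) (tens H (tens H H)) ->
  tens (tens C H) (tens (tens C H) (tens C H)) :=
  tens_map idfun (@tens_mid K C C H H) \o @tens_mid K C (tens C C) H (tens H H).
have -> : tens_map idfun tens_comul (tens_mid (comul c ⊗ comul h)) =
  mid3 (tens_map idfun comul (comul c) ⊗ tens_map idfun comul (comul h)).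
  have := @tens_ext2 K C C H H _
    (tens_map idfun tens_comul \o (@tens_mid K C C H H))
    (mid3 \o (tens_map (tens_map idfun comul) (tens_map idfun comul))).
  move/(_ _ (comul c ⊗ comul h)) => /=; rewrite tens_map_pure.
  apply=> {}c c' {}h h' /=; rewrite tens_mid_pure !tens_map_pure /mid3 /= !tens_map_pure tens_mid_pure.
  by rewrite tens_map_pure /= tens_comul_pure.
(* Coassociativity of [C] and of [H] moves the second comultiplication to the left factor, as on the
   other side of the goal. *)
rewrite -!comulA.
have := @tens_ext2 K C C H H _
  (@tens_assoc K _ _ _ \o tens_map tens_comul idfun \o (@tens_mid K C C H H))
  (mid3 \o (tens_map (@tens_assoc K _ _ _ \o tens_map comul idfun)
    (@tens_assoc K _ _ _ \o tens_map comul idfun))).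
move/(_ _ (comul c ⊗ comul h)) => /=; rewrite tens_map_pure.
apply=> {}c c' {}h h' /=.
rewrite tens_mid_pure !tens_map_pure /= !tens_map_pure tens_comul_pure.
(* The inner [comul c] and [comul h] are still general tensors; with [c'] and [h'] frozen, the
   comparison is made once more on pure tensors. *)
have := @tens_ext2 K C C H H _
  (@tens_assoc K _ _ _ \o tens_with (c' ⊗ h') \o @tens_mid K C C H H)
  (mid3 \o tens_map (@tens_assoc K _ _ _ \o tens_with c')
    (@tens_assoc K _ _ _ \o tens_with h')).
move/(_ _ (comul c ⊗ comul h)) => /=; rewrite tens_map_pure /=.
apply=> {}c c2 {}h h2 /=.
rewrite tens_mid_pure tens_map_pure /= /tens_with !tens_assoc_pure /mid3 /=.
by rewrite tens_mid_pure tens_map_pure /= tens_mid_pure.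
Qed.

Let tens_counitl (x : tens C H) :
  tlift (fun x1 x2 => tens_counit x1 *: x2) (tens_comul x) = x.
Proof.
have B : tbilinear (fun x1 x2 : tens C H => tens_counit x1 *: x2).
  split=> [y a z z'|y a z z']; rewrite linearP //=.
  by rewrite scalerDl scalerA.
elim/tens_ind: x => [|c h|x y hx hy].
- by rewrite linear0 (tlift0 (tbilinear_balanced B)).
- rewrite tens_comul_pure tlift_tens_mid //.
  (* Expanding [c] and [h] on the right by their own counit axioms makes the nested sums agree term
     by term. *)
  rewrite -[c in RHS]counitl -[h in RHS]counitl.
  rewrite (linear_tlift _ _ (@tpure_linearl _ _ _ _)).
  apply: eq_tlift => c1 c2.
  rewrite (linear_tlift _ _ (@tpure_linearr _ _ _ _)).
  apply: eq_tlift => h1 h2.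
  by rewrite tens_counit_pure tpureZl tpureZr scalerA.
- by rewrite linearD (tliftD (tbilinear_balanced B)) /= hx hy.
Qed.

Let tens_counitr (x : tens C H) :
  tlift (fun x1 x2 => tens_counit x2 *: x1) (tens_comul x) = x.
Proof.
have B : tbilinear (fun x1 x2 : tens C H => tens_counit x2 *: x1).
  split=> [y a z z'|y a z z']; rewrite linearP //=.
  by rewrite scalerDl scalerA.
elim/tens_ind: x => [|c h|x y hx hy].
- by rewrite linear0 (tlift0 (tbilinear_balanced B)).
- rewrite tens_comul_pure tlift_tens_mid //.
  rewrite -[c in RHS]counitr -[h in RHS]counitr.
  rewrite (linear_tlift _ _ (@tpure_linearl _ _ _ _)).
  apply: eq_tlift => c1 c2.
  rewrite (linear_tlift _ _ (@tpure_linearr _ _ _ _)).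
  apply: eq_tlift => h1 h2.
  by rewrite tens_counit_pure tpureZl tpureZr scalerA.
- by rewrite linearD (tliftD (tbilinear_balanced B)) /= hx hy.
Qed.

HB.instance Definition _ :=
  isCoalgebra.Build K (tens C H) tens_comulA tens_counitl tens_counitr.

Lemma comul_tpure (c : C) (h : H) : comul (c ⊗ h) = tens_mid (comul c ⊗ comul h).
Proof. exact: tens_comul_pure. Qed.

Lemma counit_tpure (c : C) (h : H) : counit (c ⊗ h) = counit c * counit h.
Proof. exact: tens_counit_pure. Qed.

End TensorCoalgebra.

(** * Maps compatible with comultiplication *)

Section Comultiplicative.
Variable K : fieldType.

(** The counit is left out because partial actions and left multiplication by a grouplike need not
    preserve it. *)
Definition comultiplicative (X Y : coalgType K) (f : X -> Y) :=
  forall x, comul (f x) = tens_map f f (comul x).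

Lemma comultiplicative_id (X : coalgType K) : comultiplicative (@idfun X).
Proof. by move=> x; rewrite tens_map_id. Qed.

Lemma tens_mid_map (V V' W W' U U' T T' : lmodType K) (f : {linear V -> U})
    (f' : {linear V' -> U'}) (g : {linear W -> T}) (g' : {linear W' -> T'}) x :
  tens_mid (tens_map (tens_map f f') (tens_map g g') x) =
  tens_map (tens_map f g) (tens_map f' g') (tens_mid x).
Proof.
have := @tens_ext2 K V V' W W' _
  (@tens_mid _ _ _ _ _ \o tens_map (tens_map f f') (tens_map g g'))
  (tens_map (tens_map f g) (tens_map f' g') \o @tens_mid _ _ _ _ _).
apply=> v w v' w' /=.
by rewrite tens_map_pure /= !tens_map_pure !tens_mid_pure !tens_map_pure /=
  !tens_map_pure.
Qed.

Lemma comultiplicative_tens_map (X X' Y Y' : coalgType K) (f : {linear X -> Y})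
    (g : {linear X' -> Y'}) :
    comultiplicative f -> comultiplicative g ->
  comultiplicative (tens_map f g).
Proof.
move=> fM gM; elim/tens_ind => [|x x'|x y hx hy]; rewrite ?linear0 //=.
  rewrite tens_map_pure !comul_tpure fM gM -tens_mid_map.
  by rewrite tens_map_pure.
by rewrite !linearD /= hx hy.
Qed.

(** Translates the Sweedler form of the action axioms into comultiplicativity of [f] on the tensor
    coalgebra. *)
Lemma sweedler_tens_map (X Y Z : coalgType K) (f : {linear tens X Y -> Z}) x y :
  \sw_(x1, x2 <- x) \sw_(y1, y2 <- y) (f (x1 ⊗ y1) ⊗ f (x2 ⊗ y2)) =
  tens_map f f (comul (x ⊗ y)).
Proof. by rewrite comul_tpure [RHS]tlift_tens_mid //; apply: tens_map_bilinear. Qed.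

End Comultiplicative.

(** * The space of fixed points of a linear endomorphism *)

Section FixedPoints.
Variables (K : fieldType) (X : lmodType K) (P : {linear X -> X}).

Definition fixed_pred : {pred X} := [pred x | P x == x].

Fact fixed_submod_closed : submod_closed fixed_pred.
Proof.
split=> [|a x y]; rewrite !inE ?linear0 // => /eqP Px /eqP Py.
by rewrite linearP Px Py.
Qed.

HB.instance Definition _ :=
  GRing.isSubmodClosed.Build K X fixed_pred fixed_submod_closed.

Record fixed := Fixed { fixed_val : X; _ : fixed_val \in fixed_pred }.

HB.instance Definition _ := [isSub for fixed_val].
HB.instance Definition _ := [Choice of fixed by <:].
HB.instance Definition _ := [SubChoice_isSubLmodule of fixed by <:].

Lemma fixed_valK (x : fixed) : P (val x) = val x.
Proof. by case: x => x /=; rewrite inE => /eqP. Qed.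

End FixedPoints.

(** * Coalgebra structure on the image of an idempotent *)

Section CoalgebraRetract.
Variables (K : fieldType) (X : coalgType K) (P : {linear X -> X}).

(** For idempotent [P] this is weaker than comultiplicativity: [comul] is only asked to send the
    image of [P] into that of [tens_map P P]. *)
Definition comul_compatible := forall x, tens_map P P (comul (P x)) = comul (P x).

(* The proofs are arguments of the type so that its coalgebra instance can be
   inferred from the type alone. *)
Definition retract of (forall x, P (P x) = P x) & comul_compatible : Type :=
  fixed P.

Hypothesis PP : forall x, P (P x) = P x.
Hypothesis Pcomul : comul_compatible.

Local Notation D := (retract PP Pcomul).

HB.instance Definition _ := GRing.Lmodule.copy D (fixed P).

Fact retract_proj_subproof x : P x \in fixed_pred P.
Proof. by rewrite inE PP. Qed.

Definition retract_val : D -> X := @fixed_val K X P.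
Definition retract_proj (x : X) : D := Fixed (retract_proj_subproof x).

Fact retract_val_linear : linear retract_val.
Proof. exact: (linearP (val : {linear fixed P -> X})). Qed.

HB.instance Definition _ :=
  GRing.isLinear.Build K D X _ retract_val retract_val_linear.

Fact retract_proj_linear : linear retract_proj.
Proof. by move=> a x y; apply: val_inj; rewrite /= !linearP. Qed.

HB.instance Definition _ :=
  GRing.isLinear.Build K X D _ retract_proj retract_proj_linear.

Lemma retract_valK : cancel retract_val retract_proj.
Proof. by move=> d; apply: val_inj; apply: fixed_valK. Qed.

Let i : {linear D -> X} := retract_val.
Let p : {linear X -> D} := retract_proj.

Definition retract_comul : {linear D -> tens D D} := tens_map p p \o comul \o i.
Definition retract_counit : {scalar D} := counit \o i.

(** [comul (i d)] is already fixed by [tens_map P P], so projecting its two factors to [D] and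
    including them again loses nothing. *)
Lemma tens_map_retract_comul d : tens_map i i (retract_comul d) = comul (i d).
Proof.
have Pi : P (i d) = i d by apply: fixed_valK.
rewrite /retract_comul /= tens_map_comp -[in RHS]Pi -Pcomul Pi.
exact: eq_tens_map.
Qed.

Let iiiK : cancel (tens_map i (tens_map i i)) (tens_map p (tens_map p p)).
Proof. by do 2?[apply: tens_map_can]; apply: retract_valK. Qed.

Local Notation iiE := tens_map_retract_comul.
Local Notation delta := retract_comul.

Fact retract_comulA d :
  tens_assoc (tens_map delta idfun (delta d)) = tens_map idfun delta (delta d).
Proof.
(* The triple tensor power of [i] is injective, so coassociativity is inherited from [X]. *)
apply: (can_inj iiiK); rewrite -tens_assoc_map tens_map_comp [RHS]tens_map_comp.
transitivity (tens_assoc (tens_map comul idfun (comul (i d)))).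
  congr tens_assoc; rewrite -iiE [RHS]tens_map_comp.
  by apply: eq_tens_map => x //=; apply: iiE.
rewrite comulA -iiE [LHS]tens_map_comp; apply: eq_tens_map => x //.
exact/esym/iiE.
Qed.

Fact retract_counitl d :
  tlift (fun x y => retract_counit x *: y) (delta d) = d.
Proof.
apply: (can_inj retract_valK).
rewrite (linear_tlift _ _ (linearP i)) -[RHS]counitl -iiE.
rewrite (tlift_tens_map _ _ _ (counit_scalel_bilinear X)).
by apply: eq_tlift => x y; rewrite linearZ.
Qed.

Fact retract_counitr d :
  tlift (fun x y => retract_counit y *: x) (delta d) = d.
Proof.
apply: (can_inj retract_valK).
rewrite (linear_tlift _ _ (linearP i)) -[RHS]counitr -iiE.
rewrite (tlift_tens_map _ _ _ (counit_scaler_bilinear X)).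
by apply: eq_tlift => x y; rewrite linearZ.
Qed.

HB.instance Definition _ :=
  isCoalgebra.Build K D retract_comulA retract_counitl retract_counitr.

Lemma coalgebra_retract :
  exists (D : coalgType K) (i : {linear D -> X}) (p : {linear X -> D}),
    [/\ cancel i p, (forall x, i (p x) = P x), comultiplicative i &
        forall d, counit (i d) = counit d].
Proof.
exists D, i, p; split=> // [|d]; first exact: retract_valK.
exact/esym/tens_map_retract_comul.
Qed.

End CoalgebraRetract.

(** * Module coalgebras on retracts and on [C ⊗ H] *)

Section ModuleCoalgebra.
Variables (K : fieldType) (H : weakHopfType K).

(** The last hypothesis says that the image of [i] is stable under [m]; hence [i] intertwines the
    induced action with [m], and each axiom on [D] follows from the one on [X]. *)
Lemma module_coalgebra_retract (X D : coalgType K) (m : {linear tens X H -> X})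
    (i : {linear D -> X}) (p : {linear X -> D}) :
    module_coalgebra m -> cancel i p -> comultiplicative i ->
    (forall d h, i (p (m (i d ⊗ h))) = m (i d ⊗ h)) ->
  module_coalgebra (p \o m \o tens_map i idfun).
Proof.
move=> [m1 mcomul mA] ipK iM pm; have iiK := tens_map_can ipK ipK.
have imE x : i (p (m (tens_map i idfun x))) = m (tens_map i idfun x).
  elim/tens_ind: x => [|d h|x y hx hy]; rewrite ?linear0 ?linearD /= ?hx ?hy //.
  by rewrite tens_map_pure /= pm.
split=> [d|d h|d h k] /=; rewrite !tens_map_pure /=.
- by rewrite m1 ipK.
- rewrite (sweedler_tens_map (p \o m \o tens_map i idfun)).
  apply: (can_inj iiK); rewrite -iM pm mcomul sweedler_tens_map tens_map_comp.
  rewrite -[i d ⊗ h]/(i d ⊗ idfun h) -tens_map_pure.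
  rewrite (comultiplicative_tens_map iM (@comultiplicative_id _ _)).
  by rewrite tens_map_comp; apply: eq_tens_map => x; rewrite /= imE.
- by rewrite pm mA.
Qed.

Variable C : coalgType K.

Definition tens_rmul : tens (tens C H) H -> tens C H :=
  tens_map idfun amul \o @tens_assoc K C H H.

HB.instance Definition _ := GRing.Linear.on tens_rmul.

Arguments tens_rmul : simpl never.

Lemma tens_rmul_pure c h k : tens_rmul ((c ⊗ h) ⊗ k) = c ⊗ (h ⋅ k).
Proof. by rewrite /tens_rmul /= tens_assoc_pure tens_map_pure. Qed.

(** With [comulM], this is what makes right multiplication on [C ⊗ H] comultiplicative. *)
Lemma tens_mid_rmul (y : tens C C) (z w : tens H H) :
  tens_mid (y ⊗ (z ⋅ w)) =
  tens_map tens_rmul tens_rmul (tens_mid (tens_mid (y ⊗ z) ⊗ w)).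
Proof.
have := @tens_ext3 K C C H H H H _
  (@tens_mid K C C H H \o tens_map idfun amul \o @tens_assoc K _ _ _)
  (tens_map tens_rmul tens_rmul \o @tens_mid K _ _ H H \o
   tens_map (@tens_mid K C C H H) idfun).
move/(_ _ ((y ⊗ z) ⊗ w)) => /=; rewrite tens_assoc_pure !tens_map_pure /=.
apply=> c c' h h' k k'; rewrite tens_assoc_pure !tens_map_pure /=.
by rewrite tens_mul_pure !tens_mid_pure tens_map_pure /= !tens_rmul_pure.
Qed.

Lemma tens_rmul_module_coalgebra : module_coalgebra tens_rmul.
Proof.
split=> [x|x h|x h k]; elim/tens_ind: x => [|c l|x y hx hy].
- by rewrite tpure0l linear0.
- by rewrite /= tens_rmul_pure amul1r.
- by rewrite tpureDl linearD hx hy.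
- by rewrite sweedler_tens_map !(tpure0l, linear0).
- by rewrite sweedler_tens_map /= tens_rmul_pure !comul_tpure comulM tens_mid_rmul.
- by move: hx hy; rewrite !sweedler_tens_map tpureDl !linearD /= => -> ->.
- by rewrite !(tpure0l, linear0).
- by rewrite /= !tens_rmul_pure amulA.
- by rewrite !tpureDl !linearD !tpureDl !linearD hx hy.
Qed.

End ModuleCoalgebra.

(** * Grouplike elements of a weak Hopf algebra *)

Section Grouplike.
Variables (K : fieldType) (H : weakHopfType K).

Lemma amul_linearl (A : unitalAlgType K) (b : A) : linear (fun a : A => a ⋅ b).
Proof. by move=> c x y; rewrite tpureDl tpureZl linearP. Qed.

Lemma amul_linearr (A : unitalAlgType K) (a : A) : linear (fun b : A => a ⋅ b).
Proof. by move=> c x y; rewrite tpureDr tpureZr linearP. Qed.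

Lemma tens_mul_tpurer (A B : unitalAlgType K) (x : tens A B) (a : A) (b : B) :
  x ⋅ (a ⊗ b) = tlift (fun u v => (u ⋅ a) ⊗ (v ⋅ b)) x.
Proof.
rewrite -[x in LHS]tlift_tpure (linear_tlift _ _ (amul_linearl (a ⊗ b))).
by apply: eq_tlift => u v; rewrite tens_mul_pure.
Qed.

Lemma tens_mul_tpurel (A B : unitalAlgType K) (x : tens A B) (a : A) (b : B) :
  (a ⊗ b) ⋅ x = tlift (fun u v => (a ⋅ u) ⊗ (b ⋅ v)) x.
Proof.
rewrite -[x in LHS]tlift_tpure (linear_tlift _ _ (amul_linearr (a ⊗ b))).
by apply: eq_tlift => u v; rewrite tens_mul_pure.
Qed.

(* By the antipode axiom e S(e) = eps_t(e) = eps(1_1 e) 1_2, and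
   eps(1_1 e) 1_2 e = (eps ⊗ id)(Delta(1) Delta(e)) = e. *)
Lemma grouplike_antipodeK (e : H) : comul e = e ⊗ e -> e ⋅ antipode e ⋅ e = e.
Proof.
move=> he.
have antipodeB : tbilinear (fun h1 h2 : H => h1 ⋅ antipode h2).
  split=> [h|h a v w]; first exact: amul_linearl.
  by rewrite linearP; apply: amul_linearr.
have -> : e ⋅ antipode e = eps_t e by rewrite -antipode_t he tlift_bilinear_pure.
rewrite -[RHS]counitl -[in RHS](amul1l e) comulM he tens_mul_tpurer.
rewrite (linear_tlift _ _ (tlift_linear (counit_scalel_bilinear H))).
rewrite /eps_t (linear_tlift _ _ (amul_linearl e)); apply: eq_tlift => u v.
by rewrite tlift_bilinear_pure ?tpureZl ?linearZ //; apply: counit_scalel_bilinear.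
Qed.

Definition lmul (a h : H) : H := a ⋅ h.

Fact lmul_linear a : linear (lmul a).
Proof. exact: amul_linearr. Qed.

HB.instance Definition _ a := GRing.isLinear.Build K H H _ (lmul a) (lmul_linear a).

Lemma comultiplicative_lmul e : comul e = e ⊗ e -> comultiplicative (lmul e).
Proof. by move=> he h; rewrite /lmul comulM he tens_mul_tpurel. Qed.

Lemma comultiplicative_tens_with (C : coalgType K) (e : H) :
  comul e = e ⊗ e -> comultiplicative (tens_with e : C -> tens C H).
Proof.
move=> he c; rewrite comul_tpure he tens_midE.
by apply: eq_tlift => c1 c2; rewrite tlift_bilinear_pure //; apply: tpure2_bilinear.
Qed.

End Grouplike.

(** * The partial action as a map on the coalgebra [C ⊗ H] *)

Section PartialAction.
Variables (K : fieldType) (H : weakHopfType K) (C : coalgType K).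
Variables (act : {linear tens C H -> C}).
Hypothesis actP : partial_module_coalgebra act.

Lemma pact_comultiplicative : comultiplicative act.
Proof.
elim/tens_ind => [|c h|x y hx hy]; first by rewrite !linear0.
  by rewrite (pact_comul actP) sweedler_tens_map.
by rewrite !linearD hx hy.
Qed.

Lemma pact_counit_bilinear h : tbilinear (fun x y : tens C H =>
  counit (act x) *: act (tens_rmul (y ⊗ h))).
Proof.
split=> [z a x y|z a x y]; first by rewrite !linearP scalerDl scalerA.
by rewrite tpureDl tpureZl !linearP.
Qed.

(** Extends [pactA] by linearity from pure tensors, because elements of the globalization are in
    general sums of such. *)
Lemma pactA_tens (x : tens C H) h :
  act (act x ⊗ h) =
  \sw_(x1, x2 <- x) (counit (act x1) *: act (tens_rmul (x2 ⊗ h))).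
Proof.
have B := pact_counit_bilinear h.
elim/tens_ind: x => [|c k|x y hx hy].
- by rewrite !linear0 tpure0l linear0 (tlift0 (tbilinear_balanced B)).
- rewrite (pactA actP) comul_tpure tlift_tens_mid //.
  apply: eq_tlift => c1 c2; apply: eq_tlift => k1 k2.
  by rewrite tens_rmul_pure.
- by rewrite !linearD tpureDl linearD (tliftD (tbilinear_balanced B)) /= hx hy.
Qed.

End PartialAction.

(** * Construction of the globalization on [C ⊗ eH] *)

Theorem mainTheorem5 (K : fieldType) (H : weakHopfType K) (C : coalgType K)
    (act : {linear tens C H -> C}) (hact : partial_module_coalgebra act)
    (e : H) (he : comul e = e ⊗ e)
    (hce : forall (c : C) (h : H), act (c ⊗ (h ⋅ e)) = act (c ⊗ h)) :
  has_globalization act.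
Proof.
pose S := antipode e.
(* Left multiplication by [e S(e)] is factored as [Q \o R] so that the comultiplicativity of [Q],
   immediate for a grouplike [e], suffices without computing [comul S]. *)
pose Q : {linear tens C H -> tens C H} := tens_map idfun (lmul e).
pose R : {linear tens C H -> tens C H} := tens_map idfun (lmul S).
pose P : {linear tens C H -> tens C H} := Q \o R.
have QE c h : Q (c ⊗ h) = c ⊗ (e ⋅ h) by apply: tens_map_pure.
have RE c h : R (c ⊗ h) = c ⊗ (S ⋅ h) by apply: tens_map_pure.
have PE x : P x = Q (R x) by [].
have QM : comultiplicative Q.
  apply: comultiplicative_tens_map; first exact: comultiplicative_id.
  exact: comultiplicative_lmul.
clearbody P Q R.
(* Here [e S(e) e = e] makes [P] the identity on the image of [Q], so both have the image
   [C ⊗ eH]. *)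
have PQ x : P (Q x) = Q x.
  elim/tens_ind: x => [|c h|x y hx hy]; rewrite ?linear0 ?linearD ?hx ?hy //.
  by rewrite QE PE RE QE !amulA grouplike_antipodeK.
have PP x : P (P x) = P x by rewrite [P x]PE PQ.
have Pcomul : comul_compatible P.
  move=> x; rewrite PE QM tens_map_comp.
  by apply: eq_tens_map => y; apply: PQ.
have [D [i [p [ipK piE iM iC]]]] := coalgebra_retract PP Pcomul.
have Pi d : P (i d) = i d by rewrite -piE ipK.
(* Left multiplication by [e] commutes with right multiplication, so the image of [Q] is stable
   under the action of [H]. *)
have rmulQ x h : tens_rmul (Q x ⊗ h) = Q (tens_rmul (x ⊗ h)).
  elim/tens_ind: x => [|c k|x y hx hy].
  - by rewrite !(linear0, tpure0l).
  - by rewrite QE !tens_rmul_pure QE amulA.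
  - by rewrite linearD !tpureDl !linearD /= hx hy.
have Qi d : Q (R (i d)) = i d by rewrite -PE.
have pm d h : i (p (tens_rmul (i d ⊗ h))) = tens_rmul (i d ⊗ h).
  by rewrite piE -Qi rmulQ PQ.
pose actD : {linear tens D H -> D} :=
  p \o @tens_rmul K H C \o tens_map i idfun.
have actDM : module_coalgebra actD.
  by apply: module_coalgebra_retract => //; apply: tens_rmul_module_coalgebra.
have actDE d h : i (actD (d ⊗ h)) = tens_rmul (i d ⊗ h).
  by rewrite /actD /= tens_map_pure.
clearbody actD.
pose theta : {linear C -> D} := p \o tens_with e.
have act_e c : act (c ⊗ e) = c.
  by rewrite -[e]amul1l hce (pact1 hact).
have act_eh c h : act (c ⊗ (e ⋅ h)) = act (c ⊗ h).
  have B c1 c2 : tbilinear (fun h1 h2 : H =>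
      counit (act (c1 ⊗ h1)) *: act (c2 ⊗ (h2 ⋅ h))).
    split=> [k a k1 k2|k a k1 k2].
      by rewrite tpureDr tpureZr !linearP /= scalerDl scalerA.
    by rewrite tpureDl tpureZl linearP tpureDr tpureZr !linearP.
  (* The sum over [comul e] has the single term [e ⊗ e], and [c1 ↼ e = c1]; the counit axiom of [C]
     then collapses the sum to [c ↼ eh]. *)
  rewrite -[in RHS](act_e c) (pactA hact) he -[in LHS](counitl c).
  have L : linear (fun c' => act (c' ⊗ (e ⋅ h))).
    by move=> a c1 c2; rewrite tpureDl tpureZl linearP.
  rewrite (linear_tlift _ _ L); apply: eq_tlift => c1 c2.
  by rewrite tlift_bilinear_pure // act_e tpureZl linearZ.
have thetaE c : i (theta c) = c ⊗ e.
  by rewrite /theta /= piE /tens_with PE RE QE !amulA grouplike_antipodeK.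
clearbody theta.
have thetaM : comultiplicative theta.
  move=> c; apply: (can_inj (tens_map_can ipK ipK)); rewrite -iM thetaE.
  rewrite -[c ⊗ e]/(tens_with e c) comultiplicative_tens_with // tens_map_comp.
  by apply: eq_tens_map => c'; rewrite /= thetaE.
have actM := pact_comultiplicative hact.
pose proj : {linear D -> D} := theta \o act \o i.
have projE d : proj d = theta (act (i d)) by [].
clearbody proj.
have projM : comultiplicative proj.
  move=> d; rewrite projE thetaM actM iM !tens_map_comp.
  by apply: eq_tens_map => x; rewrite projE.
(* Thus [act \o i] is a left inverse of [theta], which gives both the injectivity of [theta] and the
   idempotency of [proj]. *)
have act_theta c : act (i (theta c)) = c by rewrite thetaE.
have theta_counit c : counit (theta c) = counit c.
  (* Concluding [counit e = 1] would require [e] to be nonzero; this form holds in every case and is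
     applied inside [c = act (c ⊗ e)]. *)
  have eE : counit e *: e = e.
    by rewrite -[RHS]counitl he tlift_bilinear_pure //; apply: counit_scalel_bilinear.
  rewrite -iC thetaE counit_tpure -[in RHS](act_e c) -[in RHS]eE.
  by rewrite tpureZr !linearZ act_e mulrC.
exists D, actD, theta, proj; split.
- exact: actDM.
- by split=> //; apply: (can_inj (g := act \o i)) => c; apply: act_theta.
- split=> [d|d]; first by rewrite !projE act_theta.
  split=> [[d' <-]|[c <-]]; first by exists (act (i d')); rewrite projE.
  by exists (theta c); rewrite projE act_theta.
- by move=> d h; rewrite projM.
(* By [act_eh] the left side is [theta] of [act (act (i d) ⊗ h)]; [pactA_tens] expands it over
   [comul (i d)], which [iM] carries back to [comul d]. *)
- move=> d h; rewrite !projE actDE thetaE tens_rmul_pure act_eh.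
  rewrite (pactA_tens hact) iM.
  rewrite (tlift_tens_map _ _ _ (pact_counit_bilinear act h)).
  rewrite (linear_tlift _ _ (linearP theta)); apply: eq_tlift => d1 d2.
  by rewrite linearZ !projE theta_counit actDE.
- by move=> c h; rewrite projE actDE thetaE tens_rmul_pure act_eh.
(* The witness is read off [i d = Q (R (i d))]: a term [c ⊗ h] of a representative of [i d] becomes
   [c ⊗ (e ⋅ (S ⋅ h))], that is, [theta c] acted on by [S ⋅ h]. *)
- move=> d; exists [seq (q.1, S ⋅ q.2) | q <- repr (i d)].
  apply: (can_inj ipK); rewrite big_map linear_sum -[LHS]Qi.
  rewrite [X in Q (R X)]tensE !linear_sum; apply: eq_bigr => q _.
  by rewrite actDE thetaE tens_rmul_pure /= RE QE.
Qed.
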